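(* For a positive integer $N$, let $B(N)$ denote the number of triples $(a,b,r)$ of positive integers such that $r \mid ab$ and $ab \leq N$, and let $A(N)$ denote the number of those triples $(a,b,r)$ (that is, with $r \mid ab$ and $ab \le N$) for which, in addition, $r$ divides at least one of $a$ and $b$. Then $$\frac{A(N)}{B(N)} \sim \frac{\pi^2}{\log N} \quad \text{as } N \to \infty.$$
   Context: Here $\log$ is the natural logarithm, and $f(N) \sim g(N)$ as $N \to \infty$ means $\lim_{N\to\infty} f(N)/g(N) = 1$. Triples are ordered. *)

(* Defs.v *)
From mathcomp Require Import all_boot all_order all_algebra.
From mathcomp Require Import finmap.
From mathcomp Require Import all_classical all_reals all_analysis.

Set Implicit Arguments.
Unset Strict Implicit.
Unset Printing Implicit Defensive.

Import Order.TTheory GRing.Theory Num.Theory.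
Import numFieldNormedType.Exports.

Local Open Scope classical_set_scope.

Definition Bset (N : nat) : set (nat * nat * nat) :=
  [set t | let: (a, b, r) := t in
    [/\ (0 < a)%N, (0 < b)%N, (0 < r)%N, (r %| a * b)%N & (a * b <= N)%N]].

Definition Aset (N : nat) : set (nat * nat * nat) :=
  [set t | Bset N t /\
    let: (a, b, r) := t in (r %| a)%N \/ (r %| b)%N].

(* fset_set sends an infinite set to the empty one, so these cardinals are
   meaningful because of the two lemmas below. *)
Definition B (N : nat) : nat := #|` fset_set (Bset N)|%fset.

Definition A (N : nat) : nat := #|` fset_set (Aset N)|%fset.

Lemma finite_Bset N : finite_set (Bset N).
Proof.
apply: (@sub_finite_set _ _ (`I_N.+1 `*` `I_N.+1 `*` `I_N.+1)).
  move=> [[a b] r] [a0 b0 r0 rab abN] /=; rewrite !ltnS.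
  split; [split|].
  - exact: leq_trans (leq_pmulr a b0) abN.
  - exact: leq_trans (leq_pmull b a0) abN.
  - by apply: leq_trans (dvdn_leq _ rab) abN; rewrite muln_gt0 a0.
by do 2?apply: finite_setX; apply: finite_II.
Qed.

Lemma finite_Aset N : finite_set (Aset N).
Proof. by apply: sub_finite_set (finite_Bset N) => t []. Qed.

(* Main.v *)
Require Import Defs.
From mathcomp Require Import all_boot all_order all_algebra.
From mathcomp Require Import finmap.
From mathcomp Require Import all_classical all_reals all_analysis.
From mathcomp Require Import zify ring lra.
Import Order.TTheory GRing.Theory Num.Theory.
Import numFieldNormedType.Exports.
Local Open Scope classical_set_scope.
Local Open Scope ring_scope.

(** Write L for log N and d_k(n) for the number of ways to write n as an
    ordered product of k factors.  The point is that both counts reduce to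
    the summatory functions of d_3 and d_4, which are easy to estimate.

    For A: since [P or Q] + [P and Q] = [P] + [Q], the triples counted by A
    together with those for which r divides both a and b are twice the
    triples with r | a.  The latter are the factorisations r s b <= N, so
    their number is the summatory function of d_3, asymptotic to N L^2 / 2.
    Those with r dividing both entries number only O(N L).  Hence
    A(N) ~ N L^2 ([A_add_common_divisors], [common_divisors_negligible]).

    For B: summing over the multiples ab of a that r divides gives
    B(N) = sum over a, r of floor(N / lcm(a, r)), which is the sum of
    d_2(n)^2 over n <= N.  Sorting pairs by their gcd turns both this sum and
    the summatory function of d_4 into sums over coprime pairs, and the two
    differ exactly by a free square factor: the sum of B(N / k^2) over k is
    the summatory function of d_4 ([sum_B_square]), which is asymptotic to
    N L^3 / 6.  Inverting this relation divides the constant by zeta(2), so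
    B(N) ~ N L^3 / pi^2.

    Three analytic facts carry the argument.
    - [sum_floor_asymptotic]: if F is nondecreasing and F(n) ~ l n log^k n,
      then the sum of F(floor(N/m)) over m is ~ l/(k+1) N L^(k+1).  Abel
      summation reduces it to the Stolz-Cesaro theorem, and iterating it from
      F(n) = n gives the summatory functions of all the d_k.
    - [square_inversion]: the inversion of the sum over squares.  It does not
      go through the Moebius function: the deviation f of a solution from its
      expected main term satisfies f(N) = o - (sum of f(N/k^2) over k >= 2),
      and the sum of 1/k^2 over k >= 2 is at most 3/4, so each pass through
      this identity shrinks the relative size of f by a fixed factor.
    - [basel_sum]: zeta(2) = pi^2/6, from the duplication formula
      1/sin^2 x + 1/cos^2 x = 4/sin^2 (2x). *)

(** * Counting: floor sums and greatest common divisors *)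

Section Counting.
Local Open Scope nat_scope.

Lemma sum_widen (X M : nat) (F : nat -> nat) :
  M <= X -> (forall i, M < i -> F i = 0) ->
  \sum_(1 <= i < M.+1) F i = \sum_(1 <= i < X.+1) F i.
Proof.
move=> MX F0; rewrite [RHS](@big_cat_nat _ _ _ M.+1) //=.
by rewrite [X in _ = _ + X]big_nat_cond [X in _ = _ + X]big1 ?addn0 //
  => i /andP[/andP[/F0]].
Qed.

Lemma sum_multiples (r X : nat) (F : nat -> nat) : 0 < r ->
  (forall i, X < i -> F i = 0) ->
  \sum_(1 <= a < X.+1 | r %| a) F a = \sum_(1 <= s < X.+1) F (r * s).
Proof.
move=> r0 F0.
transitivity (\sum_(1 <= s < X.+1) \sum_(1 <= a < X.+1 | a == r * s) F a); last first.
  apply: eq_big_nat => s /andP[s0 sX]; have [rsX|rsX] := ltnP (r * s) X.+1.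
    by rewrite big_nat1_eq rsX muln_gt0 r0 s0.
  rewrite F0 // big_nat_cond big1 // => a /andP[/andP[a0 aX] /eqP ars].
  by move: aX; rewrite ars ltnNge rsX.
rewrite (exchange_big_dep_nat xpredT) //=.
rewrite big_mkcond; apply: eq_big_nat => a /andP[a0 aX].
case: ifPn => [ra|ra]; last first.
  by rewrite big1 // => s /eqP ars; move: ra; rewrite ars dvdn_mulr.
rewrite (eq_bigl (pred1 (a %/ r))) => [|s /=]; last first.
  by rewrite -[in LHS](divnK ra) mulnC eqn_pmul2l // eq_sym.
by rewrite big_nat1_eq divn_gt0 // dvdn_leq //= (leq_ltn_trans (leq_div _ _)).
Qed.

Lemma divn_count (X N m : nat) : 0 < m -> N <= X ->
  N %/ m = \sum_(1 <= i < X.+1) (m * i <= N).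
Proof.
move=> m0 NX; rewrite -(@sum_widen X (N %/ m)); first last.
- by move=> i; rewrite ltn_divLR // => Ni; rewrite mulnC leqNgt Ni.
- exact: leq_trans (leq_div _ _) NX.
rewrite (eq_big_nat _ _ (F2 := fun=> 1)) ?sum_nat_const_nat ?muln1 ?subn1 //.
by move=> i /andP[i0]; rewrite ltnS leq_divRL // mulnC => ->.
Qed.

(** Each pair is [k * x, k * y] with [x] and [y] coprime for exactly one [k],
    its gcd.  Letting all indices run up to the same bound [X], beyond which
    [F] vanishes, avoids ranges such as [x <= X %/ k]. *)
Lemma sum_coprime (X : nat) (F : nat -> nat -> nat) :
  (forall a b, X < a -> F a b = 0) -> (forall a b, X < b -> F a b = 0) ->
  \sum_(1 <= a < X.+1) \sum_(1 <= b < X.+1) F a b =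
  \sum_(1 <= k < X.+1) \sum_(1 <= x < X.+1)
    \sum_(1 <= y < X.+1 | coprime x y) F (k * x) (k * y).
Proof.
move=> Fl Fr.
transitivity (\sum_(1 <= k < X.+1) \sum_(1 <= a < X.+1 | k %| a)
   \sum_(1 <= b < X.+1 | k %| b) (gcdn a b == k) * F a b).
  under [RHS]eq_bigr do rewrite big_mkcond.
  rewrite [RHS]exchange_big_nat /=; apply: eq_big_nat => a /andP[a0 aX].
  transitivity (\sum_(1 <= k < X.+1) \sum_(1 <= b < X.+1) (gcdn a b == k) * F a b).
    rewrite [RHS]exchange_big_nat /=; apply: eq_big_nat => b /andP[b0 bX].
    rewrite -big_distrl /= (eq_bigr (fun i => if i == gcdn a b then 1 else 0)); last first.
      by move=> i _; rewrite eq_sym; case: eqP.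
    have gX : gcdn a b < X.+1.
      by apply: leq_ltn_trans aX; rewrite dvdn_leq // dvdn_gcdl.
    by rewrite -big_mkcond big_nat1_eq gcdn_gt0 a0 gX mul1n.
  apply: eq_big_nat => k /andP[k0 kX]; case: ifPn => ka.
    rewrite [RHS]big_mkcond; apply: eq_bigr => b _; case: ifPn => // kb.
    by case: eqP kb => // <-; rewrite dvdn_gcdr.
  rewrite big1 // => b _; by case: eqP ka => // <-; rewrite dvdn_gcdl.
apply: eq_big_nat => k /andP[k0 kX].
rewrite sum_multiples //; last first.
  by move=> a aX; rewrite big1 // => b _; rewrite Fl // muln0.
apply: eq_big_nat => x /andP[x0 xX].
rewrite sum_multiples //; last by move=> b bX; rewrite Fr // muln0.
rewrite [RHS]big_mkcond; apply: eq_big_nat => y _.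
by rewrite -muln_gcdr -{2}[k]muln1 eqn_pmul2l // /coprime; case: eqP; rewrite ?mul1n.
Qed.

(** As [b] varies, [a * b] runs over the multiples of [a]; those that [r]
    divides are the multiples of [lcmn a r]. *)
Lemma sum_floor_lcm (N a r : nat) : 0 < a -> 0 < r ->
  \sum_(1 <= b < N.+1) ((r %| a * b) && (a * b <= N)) = N %/ lcmn a r.
Proof.
move=> a0 r0; rewrite -(@sum_multiples a N (fun n => (r %| n) && (n <= N))) //; last first.
  by move=> i; rewrite ltnNge => /negbTE ->; rewrite andbF.
rewrite (@divn_count N) ?lcmn_gt0 ?a0 //.
rewrite -(@sum_multiples _ N (fun n => (n <= N) : nat)) ?lcmn_gt0 ?a0 //; last first.
  by move=> i; rewrite ltnNge => /negbTE ->.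
rewrite big_mkcond [RHS]big_mkcond; apply: eq_bigr => n _; rewrite dvdn_lcm.
by case: (a %| n); case: (r %| n).
Qed.

Lemma card_fset_set_triples (P : nat -> nat -> nat -> bool)
    (S : set (nat * nat * nat)) (N : nat) :
  finite_set S ->
  (forall a b r, S (a, b, r) <-> [/\ 0 < a <= N, 0 < b <= N, 0 < r <= N & P a b r]) ->
  #|` fset_set S|%fset =
  \sum_(1 <= a < N.+1) \sum_(1 <= b < N.+1) \sum_(1 <= r < N.+1) P a b r.
Proof.
move=> finS SP; pose I := index_iota 1 N.+1.
pose s := [seq t <- [seq (ab, r) | ab <- [seq (a, b) | a <- I, b <- I], r <- I]
           | P t.1.1 t.1.2 t.2].
have pS : perm_eq (fset_set S) s.
  apply: uniq_perm; first exact: fset_uniq.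
    rewrite filter_uniq // !allpairs_uniq ?iota_uniq //.
    - by move=> [? ?] [? ?] _ _ [-> ->].
    - by move=> [? ?] [? ?] _ _ [-> ->].
  move=> [[a b] r]; rewrite in_fset_set // mem_filter /=.
  apply/idP/idP.
    rewrite inE => /SP[ha hb hr ->]; apply: allpairs_f; last by rewrite mem_index_iota.
    by apply: allpairs_f; rewrite mem_index_iota.
  move=> /andP[Pabr /allpairsP[[[a' b'] r'] /= [/allpairsP[[a1 b1]/= [h1 h2 [-> ->]]] h3 [? ? ?]]]].
  by subst; move: h1 h2 h3; rewrite !mem_index_iota !ltnS inE => h1 h2 h3; apply/SP; split.
rewrite (perm_size pS) size_filter -sum1_count big_mkcond /= big_allpairs_dep /=.
rewrite big_allpairs_dep; apply: eq_bigr => a _; apply: eq_bigr => b _.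
by apply: eq_bigr => r _; case: (P a b r).
Qed.

Lemma Bset_box N a b r : Bset N (a, b, r) <->
  [/\ 0 < a <= N, 0 < b <= N, 0 < r <= N & (r %| a * b) && (a * b <= N)].
Proof.
rewrite /Bset /=; split.
  move=> [a0 b0 r0 rab abN]; rewrite rab abN a0 b0 r0 /=; split => //.
  - exact: leq_trans (leq_pmulr a b0) abN.
  - exact: leq_trans (leq_pmull b a0) abN.
  - by apply: leq_trans (dvdn_leq _ rab) abN; rewrite muln_gt0 a0.
by move=> [/andP[? _] /andP[? _] /andP[? _] /andP[? ?]].
Qed.

Lemma B_sum_floor_lcm N :
  B N = \sum_(1 <= a < N.+1) \sum_(1 <= r < N.+1) N %/ lcmn a r.
Proof.
rewrite /B (card_fset_set_triples _ _ _ (finite_Bset N) (Bset_box N)).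
apply: eq_big_nat => a /andP[a0 _]; rewrite exchange_big_nat /=.
by apply: eq_big_nat => r /andP[r0 _]; rewrite sum_floor_lcm.
Qed.

(** The number of [k.+1]-tuples of positive integers with product at most
    [N], that is the summatory function of the divisor function d_(k+1). *)
Fixpoint divsum (k N : nat) : nat :=
  if k is k'.+1 then \sum_(1 <= m < N.+1) divsum k' (N %/ m) else N.

Lemma divsum0 k : divsum k 0 = 0.
Proof. by case: k => //= k; rewrite big_nil. Qed.

Lemma leq_divsum k : {homo divsum k : m n / m <= n}.
Proof.
elim: k => //= k IH m n mn.
rewrite (@sum_widen n) // => [|i mi]; last by rewrite divn_small ?divsum0.
by apply: leq_sum => i _; apply/IH/leq_div2r.
Qed.

(** Nested floors commute, so the inequality [m * (N %/ m) <= N] passes from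
    the innermost quotient to the whole sum. *)
Lemma divsum_div k m N : 0 < m -> m * divsum k (N %/ m) <= divsum k N.
Proof.
move=> m0; elim: k N => [|k IH] N /=; first by rewrite mulnC leq_divM.
rewrite (@sum_widen N) ?leq_div // => [|i mi]; last by rewrite divn_small ?divsum0.
rewrite big_distrr /=; apply: leq_sum => i _.
by rewrite divnAC; apply: IH.
Qed.

Lemma divsum_widen k X N : N <= X ->
  divsum k.+1 N = \sum_(1 <= m < X.+1) divsum k (N %/ m).
Proof.
by move=> NX /=; apply: sum_widen => // i mi; rewrite divn_small ?divsum0.
Qed.

Lemma divn_lcm_small M a b : M < a -> M %/ lcmn a b = 0.
Proof.
move=> Ma; have [->|l0] := posnP (lcmn a b); first by rewrite divn0.
by apply/divn_small/(leq_trans Ma)/dvdn_leq; rewrite ?dvdn_lcml.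
Qed.

Lemma B_sum_floor_lcm_widen X N : N <= X ->
  B N = \sum_(1 <= a < X.+1) \sum_(1 <= r < X.+1) N %/ lcmn a r.
Proof.
move=> NX; rewrite B_sum_floor_lcm (@sum_widen X N) // => [|a Na]; last first.
  by rewrite big1 // => r _; rewrite divn_lcm_small.
apply: eq_bigr => a _; apply: sum_widen => // r Nr.
by rewrite lcmnC divn_lcm_small.
Qed.

(** Both sides sum [N %/ (k ^ 2 * g * x * y)] over all [k], [g] and all coprime
    [x], [y].  On the left, [g] is the gcd of the pair [(a, r)] and
    [lcmn a r = g * x * y]; on the right, [k] is the gcd of two of the four
    factors of a 4-tuple. *)
Lemma sum_B_square N :
  \sum_(1 <= k < N.+1) B (N %/ k ^ 2) = divsum 3 N.
Proof.
transitivity (\sum_(1 <= k < N.+1) \sum_(1 <= g < N.+1) \sum_(1 <= x < N.+1)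
    \sum_(1 <= y < N.+1 | coprime x y) N %/ (k ^ 2 * (g * x * y))).
  apply: eq_bigr => k _.
  rewrite (@B_sum_floor_lcm_widen N) ?leq_div // sum_coprime; first last.
  - by move=> a b Nb; rewrite lcmnC divn_lcm_small // (leq_ltn_trans (leq_div _ _)).
  - by move=> a b Na; rewrite divn_lcm_small // (leq_ltn_trans (leq_div _ _)).
  apply: eq_bigr => g _; apply: eq_bigr => x _; apply: eq_bigr => y xy.
  rewrite -divnMA; congr (_ %/ (_ * _)).
  by rewrite -muln_lcmr /lcmn (eqP xy) divn1 mulnA.
rewrite exchange_big_nat (@divsum_widen 2 N N) //.
apply: eq_bigr => g _; rewrite (@divsum_widen 1 N) ?leq_div //.
transitivity (\sum_(1 <= x < N.+1) \sum_(1 <= y < N.+1) N %/ (g * x * y)); last first.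
  apply: eq_bigr => x _; rewrite (@divsum_widen 0 N) -?divnMA ?leq_div //.
  by apply: eq_bigr => y _; rewrite /= !divnMA.
rewrite [RHS]sum_coprime; first last.
- move=> a b Nb; have [->|m0] := posnP (g * a * b); first by rewrite divn0.
  by apply/divn_small/(leq_trans Nb)/dvdn_leq; rewrite // dvdn_mull.
- move=> a b Nb; have [->|m0] := posnP (g * a * b); first by rewrite divn0.
  by apply/divn_small/(leq_trans Nb)/dvdn_leq; rewrite // dvdn_mulr // dvdn_mull.
apply: eq_bigr => k _; apply: eq_bigr => x _; apply: eq_bigr => y _.
by congr (_ %/ _); lia.
Qed.

(** The number of triples in [Aset N] for which [r] divides both [a] and [b]:
    with [a = r * s] and [b = r * t] the condition is [r ^ 2 * s * t <= N]. *)
Definition common_divisors_sum N := \sum_(1 <= r < N.+1) divsum 1 (N %/ r ^ 2).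

Lemma sum_floor_multiples N r : 0 < r ->
  \sum_(1 <= a < N.+1) \sum_(1 <= b < N.+1) ((r %| a) && (a * b <= N)) =
  divsum 1 (N %/ r).
Proof.
move=> r0; rewrite (@divsum_widen 0 N) ?leq_div //.
transitivity (\sum_(1 <= s < N.+1) N %/ (r * s)); last first.
  by apply: eq_bigr => s _; rewrite divnMA.
rewrite -(@sum_multiples r N (fun a => N %/ a)) //; last exact: divn_small.
rewrite [RHS]big_mkcond; apply: eq_big_nat => a /andP[a0 _].
by case: (r %| a); rewrite ?(@divn_count N) // big1.
Qed.

Lemma Aset_box N a b r : Aset N (a, b, r) <->
  [/\ 0 < a <= N, 0 < b <= N, 0 < r <= N &
      ((r %| a) || (r %| b)) && (a * b <= N)].
Proof.
rewrite /Aset /=; split.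
  by move=> [/Bset_box[-> -> -> /andP[_ ->]] /orP ->].
move=> [ha hb hr /andP[rab abN]]; split; last exact/orP.
apply/Bset_box; split=> //; rewrite abN andbT.
by case/orP: rab => ?; [apply: dvdn_mulr | apply: dvdn_mull].
Qed.

(** Inclusion-exclusion on the conditions [r %| a] and [r %| b]. *)
Lemma A_add_common_divisors N :
  A N + common_divisors_sum N = (divsum 2 N).*2.
Proof.
rewrite /A (card_fset_set_triples _ _ _ (finite_Aset N) (Aset_box N)).
have -> : common_divisors_sum N = \sum_(1 <= a < N.+1) \sum_(1 <= b < N.+1)
    \sum_(1 <= r < N.+1) ((r %| a) && (r %| b) && (a * b <= N)).
  under [RHS]eq_bigr do rewrite exchange_big_nat.
  rewrite [RHS]exchange_big_nat; apply: eq_big_nat => r /andP[r0 _].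
  transitivity (\sum_(1 <= a < N.+1) if r %| a then N %/ (a * r) else 0); last first.
    apply: eq_big_nat => a /andP[a0 _]; case: ifPn => [ra|]; last by rewrite big1.
    rewrite (@divn_count N) ?muln_gt0 ?a0 //.
    under [LHS]eq_bigr do rewrite -mulnA.
    rewrite -(@sum_multiples r N (fun b => (a * b <= N) : nat)) //.
      by rewrite big_mkcond; apply: eq_bigr => b _; case: (r %| b).
    by move=> b Nb; case: leqP => //; nia.
  rewrite -big_mkcond sum_multiples //.
    rewrite (@divsum_widen 0 N) ?leq_div //; apply: eq_bigr => a _ /=.
    by rewrite -divnMA; congr (_ %/ _); nia.
  move=> a Na; apply: divn_small; nia.
rewrite -addnn -{1}(_ : \sum_(1 <= a < N.+1) \sum_(1 <= b < N.+1)
    \sum_(1 <= r < N.+1) ((r %| a) && (a * b <= N)) = divsum 2 N); last first.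
  under eq_bigr do rewrite exchange_big_nat.
  rewrite exchange_big_nat (@divsum_widen 1 N) //.
  by apply: eq_big_nat => r /andP[r0 _]; apply: sum_floor_multiples.
rewrite -(_ : \sum_(1 <= a < N.+1) \sum_(1 <= b < N.+1)
    \sum_(1 <= r < N.+1) ((r %| b) && (a * b <= N)) = divsum 2 N); last first.
  under eq_bigr do rewrite exchange_big_nat.
  rewrite exchange_big_nat (@divsum_widen 1 N) //.
  apply: eq_big_nat => r /andP[r0 _]; rewrite -sum_floor_multiples //.
  rewrite exchange_big_nat; apply: eq_bigr => a _; apply: eq_bigr => b _.
  by rewrite mulnC.
rewrite -!big_split; apply: eq_bigr => a _ /=.
rewrite -!big_split; apply: eq_bigr => b _ /=.
rewrite -!big_split; apply: eq_bigr => r _ /=.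
by case: (r %| a); case: (r %| b); case: leqP.
Qed.

End Counting.

(** * Sequences of ratios *)

Lemma cvgnP (R : realType) (u : R^nat) (l : R) :
  u n @[n --> \oo] --> l <->
  forall e : R, 0 < e -> exists N, forall n, (N <= n)%N -> `|u n - l| <= e.
Proof.
split=> [/cvgrPdist_le ul e e0|ul].
  by have [N _ hN] := ul e e0; exists N => n Nn; rewrite distrC; apply: hN.
apply/cvgrPdist_le => /= e e0; have [N hN] := ul e e0.
by exists N => // n Nn; rewrite distrC; apply: hN.
Qed.

(** The increments of [a - l * b] are eventually at most [e / 2] times those of
    [b]; summing them gives [`|a n - l * b n| <= e / 2 * b n + C], and [C] is
    absorbed since [b] tends to infinity. *)
Lemma stolz_cesaro (R : realType) (a b : R^nat) (l : R) :
  (\forall n \near \oo, b n < b n.+1) -> b n @[n --> \oo] --> +oo ->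
  (a n.+1 - a n) / (b n.+1 - b n) @[n --> \oo] --> l ->
  a n / b n @[n --> \oo] --> l.
Proof.
move=> [N0 _ b_incr] /cvgryPge b_oo /cvgnP abl; apply/cvgnP => e e0.
have e2 : 0 < e / 2 by rewrite divr_gt0.
have [N1 hN1] := abl _ e2.
pose M := maxn N0 N1.
have incr n : (M <= n)%N ->
    `|(a n.+1 - l * b n.+1) - (a n - l * b n)| <= e / 2 * (b n.+1 - b n).
  rewrite geq_max => /andP[/b_incr /= bn /hN1].
  rewrite -subr_gt0 in bn.
  have -> : a n.+1 - l * b n.+1 - (a n - l * b n) =
    ((a n.+1 - a n) / (b n.+1 - b n) - l) * (b n.+1 - b n).
    by field; rewrite lt0r_neq0.
  by rewrite normrM (gtr0_norm bn) ler_pM2r.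
have sum n : `|(a (M + n)%N - l * b (M + n)%N) - (a M - l * b M)| <=
    e / 2 * (b (M + n)%N - b M).
  elim: n => [|n IH]; first by rewrite addn0 !subrr normr0 mulr0.
  rewrite addnS; have := incr _ (leq_addr n M).
  set x := (X in `|X| <= _ -> _); set y := (X in `|X| <= _) in IH.
  rewrite (_ : _ - _ - _ = x + y); last by rewrite /x /y; ring.
  have := ler_normD x y; move: IH; lra.
pose C := `|a M - l * b M| + e / 2 * `|b M|.
have [N2 _ hN2] := b_oo (2 * C / e + 1).
exists (M + N2)%N => n Mn; have Nn : (N2 <= n)%N by lia.
have bn : 2 * C / e + 1 <= b n by apply: hN2.
have C0 : 0 <= C by rewrite addr_ge0 ?mulr_ge0 // ltW.
have bn0 : 0 < b n.
  apply: lt_le_trans bn; rewrite ltr_wpDl // divr_ge0 ?(ltW e0) //; lra.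
rewrite -[l](mulfK (lt0r_neq0 bn0)) -mulrBl normrM normfV (gtr0_norm bn0).
rewrite ler_pdivrMr //.
have := sum (n - M)%N; rewrite subnKC; last by lia.
have CE : 2 * C <= e * b n.
  have : e * (2 * C / e + 1) <= e * b n by rewrite ler_pM2l.
  rewrite mulrDr mulr1 mulrCA divff ?mulr1 ?lt0r_neq0 //; lra.
have h1 := ler_normD (a n - l * b n - (a M - l * b M)) (a M - l * b M).
rewrite subrK in h1.
have h2 : - b M <= `|b M| by rewrite -normrN ler_norm.
have h3 : e / 2 * - b M <= e / 2 * `|b M| by rewrite ler_wpM2l // ltW.
move: CE h1; rewrite /C; lra.
Qed.

Lemma cvgn_exp (R : realType) (u : R^nat) (l : R) k :
  u n @[n --> \oo] --> l -> u n ^+ k @[n --> \oo] --> l ^+ k.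
Proof.
move=> ul; elim: k => [|k IH]; first by under eq_fun do rewrite expr0; apply: cvg_cst.
by rewrite exprS; under eq_fun do rewrite exprS; apply: cvgM.
Qed.

(** * Logarithms of integers and sums of floors *)

Section Asymptotics.
Variable R : realType.
Local Notation L n := (ln (n%:R : R)).

Lemma ln_nat_cvgy : L n @[n --> \oo] --> +oo.
Proof.
apply/cvgryPge => A; exists (Num.bound (expR A)) => //= n An.
have An' : expR A <= n%:R.
  by apply/ltW/(lt_le_trans (archi_boundP (expR_ge0 _))); rewrite ler_nat.
by rewrite -[A]expRK ler_ln ?posrE ?expR_gt0 // (lt_le_trans (expR_gt0 A)).
Qed.

Lemma ln_nat_ge0 n : 0 <= L n.
Proof. by case: n => [|n]; [rewrite ln0 | rewrite ln_ge0 // ler1n]. Qed.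

Lemma ln_nat_gt0 n : (1 < n)%N -> 0 < L n.
Proof. by move=> n1; rewrite ln_gt0 // ltr1n. Qed.

Lemma ler_ln_nat m n : (m <= n)%N -> L m <= L n.
Proof.
case: m => [|m] mn; first by rewrite ln0 ?ln_nat_ge0.
by rewrite ler_ln ?posrE ?ltr0n ?ler_nat // (leq_ltn_trans _ mn).
Qed.

Lemma ln_succ_bounds n : (0 < n)%N -> (n.+1%:R)^-1 <= L n.+1 - L n <= n%:R^-1.
Proof.
move=> n0; have p : 0 < n%:R :> R by rewrite ltr0n.
have p1 : 0 < n.+1%:R :> R by rewrite ltr0n.
have e : n.+1%:R = n%:R + 1 :> R by rewrite -natr1.
rewrite -ln_div ?posrE //; apply/andP; split; last first.
  rewrite (_ : _ / _ = 1 + n%:R^-1 :> R); last by rewrite e; field; rewrite lt0r_neq0.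
  by apply: le_ln1Dx; apply: lt_trans (_ : 0 < _); rewrite ?invr_gt0 //; lra.
rewrite -[X in ln X]invrK lnV ?posrE ?invr_gt0 ?divr_gt0 // lerNr.
rewrite (_ : _^-1 = 1 + - n.+1%:R^-1 :> R); last first.
  by rewrite e; field; rewrite -?e !lt0r_neq0.
apply: le_ln1Dx; rewrite ltrN2 invf_lt1 // ltr1n ltnS //.
Qed.

Lemma natr_succ_ratio : n%:R / n.+1%:R @[n --> \oo] --> (1 : R).
Proof.
apply: (@cvg_trans _ ((1 - n.+1%:R^-1 : R) @[n --> \oo])).
  apply: near_eq_cvg; near=> n.
  by rewrite -natr1; field; rewrite natr1 pnatr_eq0.
have : (1 - n.+1%:R^-1 : R) @[n --> \oo] --> (1 - 0 : R).
  by apply: cvgB; [exact: cvg_cst | exact: cvg_harmonic].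
by rewrite subr0.
Unshelve. all: by end_near. Qed.

Lemma ln_increment : n%:R * (L n.+1 - L n) @[n --> \oo] --> (1 : R).
Proof.
apply: (@squeeze_cvgr _ _ _ _ (fun n => n%:R / n.+1%:R) (fun=> 1)); last 2 first.
- exact: natr_succ_ratio.
- exact: cvg_cst.
near=> n; have n0 : (0 < n)%N by near: n; exists 1%N.
have /andP[h1 h2] := ln_succ_bounds n n0.
rewrite ler_wpM2l //=.
apply: le_trans (_ : n%:R * n%:R^-1 <= 1); first by rewrite ler_wpM2l.
by rewrite divff // pnatr_eq0 -lt0n.
Unshelve. all: by end_near. Qed.

Lemma ln_invr0 : (L n)^-1 @[n --> \oo] --> (0 : R).
Proof.
apply/gtr0_cvgV0; last exact: ln_nat_cvgy.
by exists 2%N => // n /= n2; apply: ln_nat_gt0.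
Qed.

Lemma cvg_harmonic_nat : n%:R^-1 @[n --> \oo] --> (0 : R).
Proof. by rewrite -cvg_shiftS; apply: cvg_harmonic. Qed.

Lemma ln_succ_ratio : L n.+1 / L n @[n --> \oo] --> (1 : R).
Proof.
have h : 1 + (L n.+1 - L n) / L n @[n --> \oo] --> (1 + 0 * 0 : R).
  apply: cvgD; first exact: cvg_cst.
  apply: cvgM ln_invr0.
  apply: (@squeeze_cvgr _ _ _ _ (fun=> 0) (fun n => n%:R^-1)); last 2 first.
  - exact: cvg_cst.
  - exact: cvg_harmonic_nat.
  by exists 1%N => // n /= /ln_succ_bounds/andP[h1 ->]; rewrite (le_trans _ h1).
move: h; rewrite mulr0 addr0; apply: cvg_trans; apply: near_eq_cvg.
exists 2%N => // n /= n2; rewrite mulrBl divff ?lt0r_neq0 ?ln_nat_gt0 //.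
by rewrite addrC subrK.
Qed.

(** The discrete counterpart of the derivative of [ln ^+ k.+1], used to
    compare sums of [ln n ^+ k / n] with [ln N ^+ k.+1]. *)
Lemma ln_pow_increment k :
  n%:R * (L n.+1 ^+ k.+1 - L n ^+ k.+1) / L n ^+ k @[n --> \oo] -->
  (k.+1%:R : R).
Proof.
have h : n%:R * (L n.+1 - L n) *
    \sum_(i < k.+1) (L n.+1 / L n) ^+ (k - i) @[n --> \oo] -->
    (1 * \sum_(i < k.+1) 1 : R).
  apply: cvgM; first exact: ln_increment.
  apply: (cvg_big (op := +%R)) => [|i _]; first exact: add_continuous.
  by have := @cvgn_exp _ _ _ (k - i) ln_succ_ratio; rewrite expr1n.
move: h; rewrite sumr_const card_ord mul1r; apply: cvg_trans; apply: near_eq_cvg.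
exists 2%N => // n /= n2; have Ln := lt0r_neq0 (ln_nat_gt0 n n2).
rewrite subrXX -!mulrA; congr (_ * (_ * _)); rewrite mulr_suml; apply: eq_bigr => i _.
have ik : (i <= k)%N by rewrite -ltnS.
rewrite expr_div_n -[X in _ = _ * _ / _ ^+ X](subnK ik) exprD.
by field; rewrite !expf_neq0.
Qed.

Lemma ln_pow_cvgy k : L n ^+ k.+1 @[n --> \oo] --> +oo.
Proof.
apply/cvgryPge => A; have /cvgryPge /(_ (Num.max A 1)) := ln_nat_cvgy.
apply: filterS => n; rewrite ge_max => /andP[AL L1].
by apply: le_trans AL _; apply: ler_eXnr.
Qed.

Lemma ln_pow_incr k n : (0 < n)%N -> L n ^+ k.+1 < L n.+1 ^+ k.+1.
Proof.
move=> n0; rewrite ltrXn2r // ?nnegrE ?ln_nat_ge0 //.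
by rewrite ltr_ln ?posrE ?ltr0n // ltr_nat.
Qed.

(** Write [F (N %/ m)] as a sum of increments of [F]; the increment at [n]
    occurs for those [m] with [n * m <= N]. *)
Lemma sum_floor_abel (F : R^nat) N : F 0%N = 0 ->
  \sum_(1 <= m < N.+1) F (N %/ m)%N =
  \sum_(1 <= n < N.+1) (F n - F n.-1) * (N %/ n)%:R.
Proof.
move=> F0.
transitivity (\sum_(1 <= m < N.+1) \sum_(1 <= n < N.+1)
  (F n - F n.-1) * (n * m <= N)%:R).
  apply: eq_big_nat => m /andP[m0 _].
  transitivity (\sum_(1 <= n < (N %/ m).+1) (F n - F n.-1)).
    by rewrite big_add1 /= telescope_sumr // F0 subr0.
  rewrite (@big_nat_widen _ _ _ _ _ N.+1) ?ltnS ?leq_div // big_mkcond /=.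
  apply: eq_bigr => n _; rewrite ltnS leq_divRL //.
  by case: leqP; rewrite ?mulr1 ?mulr0.
rewrite exchange_big_nat /=; apply: eq_big_nat => n /andP[n0 _].
by rewrite -mulr_sumr -natr_sum -divn_count.
Qed.

Lemma sum_increments_div (F : R^nat) N : F 0%N = 0 ->
  \sum_(1 <= n < N.+1) (F n - F n.-1) / n%:R =
  \sum_(0 <= n < N) F n / (n%:R * n.+1%:R) + F N / N%:R.
Proof.
move=> F0; elim: N => [|N IH]; first by rewrite !big_geq // F0 mul0r addr0.
rewrite big_nat_recr //= IH [in RHS]big_nat_recr //= -!addrA; congr (_ + _).
case: N {IH} => [|N]; first by rewrite F0 !mul0r subr0 !add0r.
have : N.+2%:R != 0 :> R by rewrite pnatr_eq0.
have : N.+1%:R != 0 :> R by rewrite pnatr_eq0.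
rewrite -[N.+2%:R]natr1; move: (N.+1%:R) => x x0 x1.
by field; rewrite x0 x1.
Qed.

(** Since the increments of [F] are nonnegative, replacing the floors of
    [sum_floor_abel] by [N / n] costs at most [F N], of lower order than
    [N * ln N ^+ k.+1].  A second summation by parts leaves [N] times the sum
    of [F n / (n * (n + 1))], again up to [F N]; its terms behave
    like [l * ln n ^+ k / n], that is like [l / k.+1] times the increments of
    [ln n ^+ k.+1]. *)
Lemma sum_floor_asymptotic (F : R^nat) k (l : R) :
  F 0%N = 0 -> {homo F : m n / (m <= n)%N >-> m <= n} ->
  F n / (n%:R * L n ^+ k) @[n --> \oo] --> l ->
  (\sum_(1 <= m < N.+1) F (N %/ m)%N) / (N%:R * L N ^+ k.+1) @[N --> \oo] -->
  l / k.+1%:R.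
Proof.
move=> F0 Fmono Fl.
pose W N := \sum_(0 <= n < N) F n / (n%:R * n.+1%:R).
have WL : W n / L n ^+ k.+1 @[n --> \oo] --> l / k.+1%:R.
  apply: stolz_cesaro; last 1 first.
  - have k0 : k.+1%:R != 0 :> R by rewrite pnatr_eq0.
    have : F n / (n%:R * L n ^+ k) * (n%:R / n.+1%:R) *
        (n%:R * (L n.+1 ^+ k.+1 - L n ^+ k.+1) / L n ^+ k)^-1 @[n --> \oo]
        --> l * 1 * k.+1%:R^-1.
      by apply: cvgM; [apply: cvgM => //; apply: natr_succ_ratio
                      |apply: cvgV k0 _; apply: ln_pow_increment].
    rewrite mulr1; apply: cvg_trans.
    apply: near_eq_cvg; exists 2%N => // n /= n2.
    have -> : W n.+1 - W n = F n / (n%:R * n.+1%:R).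
      by rewrite /W big_nat_recr //= addrAC subrr add0r.
    have := lt0r_neq0 (ln_nat_gt0 n n2).
    have := ln_pow_incr k n (ltnW n2); rewrite -subr_gt0 => /lt0r_neq0.
    move: (_ - _) => D D0 L0.
    have n0 : n%:R != 0 :> R by rewrite pnatr_eq0 -lt0n ltnW.
    have : n.+1%:R != 0 :> R by rewrite pnatr_eq0.
    rewrite /=; move: (n.+1%:R) => x x0.
    by field; rewrite D0 x0 n0 expf_neq0.
  - by exists 1%N => // n /=; apply: ln_pow_incr.
  - exact: ln_pow_cvgy.
have FL : W n / L n ^+ k.+1 + F n / (n%:R * L n ^+ k) * (L n)^-1
    @[n --> \oo] --> l / k.+1%:R + l * 0.
  by apply: cvgD => //; apply: cvgM => //; apply: ln_invr0.
rewrite mulr0 addr0 in FL.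
apply: (@squeeze_cvgr _ _ _ _ (fun N => W N / L N ^+ k.+1)
  (fun n => W n / L n ^+ k.+1 + F n / (n%:R * L n ^+ k) * (L n)^-1)) => //.
exists 2%N => // N /= N2.
have N0 : 0 < N%:R :> R by rewrite ltr0n ltnW.
have LN := ln_nat_gt0 N N2.
have dF n : 0 <= F n - F n.-1 by rewrite subr_ge0; apply/Fmono/leq_pred.
have TE := @sum_increments_div F N F0; rewrite -/(W N) in TE.
rewrite sum_floor_abel //; set S := \sum_(1 <= n < N.+1) _.
have up : S <= N%:R * W N + F N.
  apply: (@le_trans _ _ (N%:R * (W N + F N / N%:R))); last first.
    by rewrite mulrDr mulrCA divff ?mulr1 ?lt0r_neq0.
  rewrite -TE mulr_sumr; apply: ler_sum_nat => n /andP[n0 _].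
  rewrite mulrCA ler_wpM2l // ler_pdivlMr ?ltr0n // -natrM ler_nat.
  exact: leq_divM.
have lo : N%:R * W N <= S.
  have -> : N%:R * W N = N%:R * (W N + F N / N%:R) - F N.
    by rewrite mulrDr mulrCA divff ?mulr1 ?lt0r_neq0 // addrK.
  have FE : F N = \sum_(1 <= n < N.+1) (F n - F n.-1).
    by rewrite big_add1 /= telescope_sumr // F0 subr0.
  rewrite -TE [X in _ - X]FE mulr_sumr -sumrB; apply: ler_sum_nat => n /andP[n0 _].
  rewrite mulrCA -[X in _ - X]mulr1 -mulrBr ler_wpM2l // lerBlDr.
  rewrite ler_pdivrMr ?ltr0n // natr1 -natrM ler_nat.
  by rewrite ltnW // ltn_ceil.
apply/andP; split.
  by rewrite ler_pdivlMr ?mulr_gt0 ?exprn_gt0 // [leLHS](_ : _ = N%:R * W N) //;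
    field; rewrite expf_neq0 ?lt0r_neq0.
rewrite ler_pdivrMr ?mulr_gt0 ?exprn_gt0 // [leRHS](_ : _ = N%:R * W N + F N) //.
by rewrite exprS; field; rewrite expf_neq0 ?lt0r_neq0.
Qed.

(** * Inverting a sum over squares *)

Lemma divn_ratio m : (0 < m)%N ->
  (N %/ m)%:R / N%:R @[N --> \oo] --> (m%:R^-1 : R).
Proof.
move=> m0; apply: (@squeeze_cvgr _ _ _ _ (fun N => m%:R^-1 - N%:R^-1) (fun=> m%:R^-1)); last 2 first.
- have : (m%:R^-1 - N%:R^-1 : R) @[N --> \oo] --> (m%:R^-1 - 0 : R).
    by apply: cvgB; [exact: cvg_cst | exact: cvg_harmonic_nat].
  by rewrite subr0.
- exact: cvg_cst.
exists 1%N => // N /= N0.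
have N0' : 0 < N%:R :> R by rewrite ltr0n.
have m0' : 0 < m%:R :> R by rewrite ltr0n.
apply/andP; split.
  rewrite ler_pdivlMr // mulrBl mulVf ?lt0r_neq0 // lerBlDr.
  by rewrite ler_pdivrMl // natr1 -natrM ler_nat mulnC ltnW // ltn_ceil.
by rewrite ler_pdivrMr // ler_pdivlMl // -natrM ler_nat mulnC leq_divM.
Qed.

Lemma ln_divn_ratio m : (0 < m)%N ->
  L (N %/ m)%N / L N @[N --> \oo] --> (1 : R).
Proof.
move=> m0; apply: (@squeeze_cvgr _ _ _ _ (fun N => 1 - L (2 * m)%N * (L N)^-1) (fun=> 1)); last 2 first.
- have : (1 - L (2 * m)%N * (L N)^-1 : R) @[N --> \oo] --> (1 - L (2 * m)%N * 0 : R).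
    apply: cvgB; first exact: cvg_cst.
    by apply: cvgM; [exact: cvg_cst | exact: ln_invr0].
  by rewrite mulr0 subr0.
- exact: cvg_cst.
exists (maxn 2 m) => // N /=; rewrite geq_max => /andP[N2 mN].
have LN := ln_nat_gt0 N N2.
have q0 : (0 < N %/ m)%N by rewrite divn_gt0.
apply/andP; split; last by rewrite ler_pdivrMr // mul1r ler_ln_nat // leq_div.
rewrite ler_pdivlMr // mulrBl mul1r -mulrA mulVf ?lt0r_neq0 // mulr1 lerBlDr.
rewrite -lnM ?posrE ?ltr0n ?muln_gt0 ?m0 // -natrM ler_ln_nat //.
have := ltn_ceil N m0; nia.
Qed.

Section Exponent.
Variable p : nat.

(** The exponent is positive, so that [n] is negligible against [g n]. *)
Let g (n : nat) : R := n%:R * L n ^+ p.+1.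

Lemma gauge_ge0 n : 0 <= g n.
Proof. by rewrite /g mulr_ge0 ?exprn_ge0 ?ln_nat_ge0. Qed.

Lemma gauge_gt0 n : (1 < n)%N -> 0 < g n.
Proof. by move=> n1; rewrite /g mulr_gt0 ?exprn_gt0 ?ln_nat_gt0 // ltr0n ltnW. Qed.

Lemma gauge_divn_le m n : (0 < m)%N -> g (n %/ m)%N <= m%:R^-1 * g n.
Proof.
move=> m0; rewrite /g mulrA ler_pM ?exprn_ge0 ?ln_nat_ge0 //.
  by rewrite ler_pdivlMl ?ltr0n // -natrM ler_nat mulnC leq_divM.
by rewrite lerXn2r ?nnegrE ?ln_nat_ge0 // ler_ln_nat // leq_div.
Qed.

Lemma gauge_divn_ratio m : g (n %/ m)%N / g n @[n --> \oo] --> (m%:R^-1 : R).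
Proof.
have [->|m0] := posnP m.
  under eq_fun do rewrite divn0 [g 0%N]/g !mul0r.
  by rewrite invr0; apply: cvg_cst.
have : (n %/ m)%:R / n%:R * (L (n %/ m)%N / L n) ^+ p.+1 @[n --> \oo]
   --> (m%:R^-1 * 1 ^+ p.+1 : R).
  apply: cvgM; first exact: divn_ratio.
  by apply: cvgn_exp; apply: ln_divn_ratio.
rewrite expr1n mulr1; apply: cvg_trans; apply: near_eq_cvg.
by apply: nearW => n /=; rewrite /g expr_div_n mulf_div.
Qed.

Variable z : R.
Let Z N : R := \sum_(1 <= k < N.+1) (k ^ 2)%:R^-1.
Hypothesis Zz : Z N @[N --> \oo] --> z.

Lemma sum_inv_sqr_le_lim N : Z N <= z.
Proof.
rewrite -(cvg_lim (@Rhausdorff R) Zz).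
apply: (@nondecreasing_cvgn_le R Z) => //; last exact: cvgP Zz.
apply/nondecreasing_seqP => n; rewrite /Z [leRHS]big_nat_recr //= lerDl.
by rewrite invr_ge0.
Qed.

(** Any bound below 1 would do for [square_inversion].  Comparing with the
    telescoping series of [1 / ((k - 1) * k)] from [k = 3] on gives 3/4. *)
Lemma sum_inv_sqr_tail N : \sum_(2 <= k < N.+1) (k ^ 2)%:R^-1 <= 3 / 4 :> R.
Proof.
have [N1|N2] := leqP N 1; first by rewrite big_geq // divr_ge0.
have : \sum_(2 <= k < N.+1) (k ^ 2)%:R^-1 <= 3 / 4 - N%:R^-1 :> R.
  elim: N N2 => // N IH; rewrite ltnS leq_eqVlt => /orP[/eqP <-|N2].
    by rewrite big_nat1 natrX; lra.
  rewrite big_nat_recr //=; last by rewrite ltnW.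
  have := IH N2; have : 0 < N%:R :> R by rewrite ltr0n ltnW.
  rewrite natrX -[N.+1%:R]natr1; move: N%:R => x x0.
  have : (x + 1) ^- 2 <= x^-1 - (x + 1)^-1.
    rewrite -subr_ge0.
    have -> : x^-1 - (x + 1)^-1 - (x + 1) ^- 2 = (x * (x + 1) ^+ 2)^-1.
      by field; rewrite !lt0r_neq0 //; lra.
    by rewrite invr_ge0 mulr_ge0 ?exprn_ge0 //; lra.
  lra.
have : 0 <= N%:R^-1 :> R by rewrite invr_ge0.
lra.
Qed.

(** Upper bound: [g (N %/ m) <= g N / m].  Lower bound: keep only the first [K]
    terms, for which the limit can be taken termwise. *)
Lemma sum_gauge_squares :
  (\sum_(1 <= k < N.+1) g (N %/ k ^ 2)%N) / g N @[N --> \oo] --> z.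
Proof.
apply/cvgnP => e e0; have e2 : 0 < e / 2 by rewrite divr_gt0.
have /cvgnP /(_ _ e2) [K hK] := Zz.
have : \sum_(1 <= k < K.+1) g (N %/ k ^ 2)%N / g N @[N --> \oo] --> Z K.
  rewrite /Z; apply: (cvg_big (op := +%R)) => [|k _]; first exact: add_continuous.
  exact: gauge_divn_ratio.
move=> /cvgnP /(_ _ e2) [M hM].
exists (maxn 2 (maxn K M)) => N; rewrite !geq_max => /and3P[N2 KN MN].
have gN := gauge_gt0 N N2.
rewrite mulr_suml.
have up : \sum_(1 <= k < N.+1) g (N %/ k ^ 2)%N / g N <= Z N.
  apply: ler_sum_nat => k /andP[k0 _]; rewrite ler_pdivrMr //.
  by apply: gauge_divn_le; rewrite expn_gt0 k0.
have lo : \sum_(1 <= k < K.+1) g (N %/ k ^ 2)%N / g N <=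
    \sum_(1 <= k < N.+1) g (N %/ k ^ 2)%N / g N.
  rewrite [leRHS](@big_cat_nat _ _ _ K.+1) //= lerDl sumr_ge0 // => k _.
  by rewrite divr_ge0 ?gauge_ge0.
have := hK K (leqnn _); have := hM N MN; have := sum_inv_sqr_le_lim N.
rewrite !ler_norml => h1 /andP[h2 h3] /andP[h4 h5].
apply/andP; split; lra.
Qed.

(** The deviation [f = E - (l / z) * g] is [O(g)] because [E] is nonnegative.
    If [`|f n| <= C * g n] eventually, then isolating the term [k = 1] of
    the sum over squares gives the same bound with [3 / 4 * C] up to [o(g)],
    hence with [5 / 6 * C]; iterating, [f] is [o(g)]. *)
Lemma square_inversion (E : R^nat) (l : R) :
  E 0%N = 0 -> (forall n, 0 <= E n) ->
  (\sum_(1 <= k < N.+1) E (N %/ k ^ 2)%N) / g N @[N --> \oo] --> l ->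
  E N / g N @[N --> \oo] --> l / z.
Proof.
move=> E0 Epos El; pose c := l / z.
have z0 : z != 0.
  by rewrite lt0r_neq0 // (lt_le_trans _ (sum_inv_sqr_le_lim 1)) // /Z big_nat1 invr_gt0.
pose f n := E n - c * g n.
have g0 : g 0%N = 0 by rewrite /g mul0r.
have f0 : f 0%N = 0 by rewrite /f E0 g0 mulr0 subrr.
pose h N := \sum_(1 <= k < N.+1) f (N %/ k ^ 2)%N.
have hg : h N / g N @[N --> \oo] --> 0.
  have : (\sum_(1 <= k < N.+1) E (N %/ k ^ 2)%N) / g N -
     c * ((\sum_(1 <= k < N.+1) g (N %/ k ^ 2)%N) / g N) @[N --> \oo] --> l - c * z.
    by apply: cvgB => //; apply: cvgM; [exact: cvg_cst | exact: sum_gauge_squares].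
  rewrite /c divfK // subrr; apply: cvg_trans; apply: near_eq_cvg.
  by apply: nearW => N /=; rewrite /h /f sumrB -mulr_sumr mulrBl mulrA.
pose P (C : R) := exists n0, forall n, (n0 <= n)%N -> `|f n| <= C * g n.
have step (C : R) : 0 < C -> P C -> P (5 / 6 * C).
  move=> C0 [n0 hn0].
  pose K := \sum_(0 <= n < n0) `|f n|.
  have K0 : 0 <= K by apply: sumr_ge0.
  (* A bound valid for all [n], and not only for large ones, is needed since
     [N %/ k ^ 2] takes small values; the correction [K * n] stays
     negligible against [g] after summation over [k]. *)
  have fK n : `|f n| <= C * g n + K * n%:R.
    have [nn|nn] := leqP n0 n.
      by apply: le_trans (hn0 _ nn) _; rewrite lerDl mulr_ge0.
    case: n nn => [|n] nn; first by rewrite f0 g0 !mulr0 addr0 normr0.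
    apply: (@le_trans _ _ K).
      by rewrite /K (bigD1_seq n.+1) ?mem_index_iota ?iota_uniq //= lerDl sumr_ge0.
    apply: (@le_trans _ _ (K * n.+1%:R)); first by rewrite ler_peMr // ler1n.
    by rewrite lerDr mulr_ge0 ?gauge_ge0 ?(ltW C0).
  (* [3 / 4 + 1 / 24 + 3 / 4 * (1 / 24)] is less than [5 / 6]. *)
  have C24 : 0 < C / 24 by rewrite divr_gt0.
  have /cvgnP /(_ _ C24) [N1 hN1] := hg.
  have /cvgryPge /(_ (24 * K / C)) [N2 _ hN2] := ln_pow_cvgy p.
  exists (maxn 2 (maxn N1 N2)) => N; rewrite !geq_max => /and3P[NN2 NN1 NN3].
  have gN := gauge_gt0 N NN2.
  have hN : `|h N| <= C / 24 * g N.
    by have := hN1 N NN1; rewrite subr0 normrM normfV (gtr0_norm gN) ler_pdivrMr.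
  have KN : K * N%:R <= C / 24 * g N.
    have := hN2 N NN3; rewrite /= ler_pdivrMr // => h1.
    rewrite /g mulrCA mulrC ler_wpM2l //; lra.
  have -> : f N = h N - \sum_(2 <= k < N.+1) f (N %/ k ^ 2)%N.
    by rewrite /h big_ltn ?ltnS ?(ltnW NN2) //= divn1 addrK.
  apply: le_trans (ler_normB _ _) _.
  have : `|\sum_(2 <= k < N.+1) f (N %/ k ^ 2)%N| <= 3 / 4 * (C * g N + K * N%:R).
    apply: le_trans (ler_norm_sum _ _ _) _.
    apply: (@le_trans _ _ (\sum_(2 <= k < N.+1) (k ^ 2)%:R^-1 * (C * g N + K * N%:R))).
      apply: ler_sum_nat => k /andP[k2 _].
      have k0 : (0 < k ^ 2)%N by rewrite expn_gt0 (ltnW k2).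
      apply: le_trans (fK _) _; rewrite mulrDr; apply: lerD.
        by rewrite [leRHS]mulrCA ler_wpM2l ?(ltW C0) //; apply: gauge_divn_le.
      rewrite [leRHS]mulrCA ler_wpM2l //.
      by rewrite ler_pdivlMl ?ltr0n // -natrM ler_nat mulnC leq_divM.
    rewrite -mulr_suml ler_wpM2r ?sum_inv_sqr_tail // addr_ge0 //.
      by rewrite mulr_ge0 ?gauge_ge0 ?(ltW C0).
    by rewrite mulr_ge0.
  have CG : 0 < C * g N by rewrite mulr_gt0.
  lra.
have [C0 C0_gt0 PC0] : exists2 C0 : R, 0 < C0 & P C0.
  exists (`|l| + 1 + `|c|); first by have := normr_ge0 l; have := normr_ge0 c; lra.
  have /cvgnP /(_ _ ltr01) [N1 hN1] := El.
  exists (maxn 2 N1) => N; rewrite geq_max => /andP[N2 NN1].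
  have gN := gauge_gt0 N N2.
  have EN : E N <= (`|l| + 1) * g N.
    have := hN1 N NN1; set S := \sum_(1 <= k < N.+1) _ => hS.
    have ES : E N <= S.
      by rewrite /S big_ltn ?ltnS ?(ltnW N2) //= divn1 lerDl sumr_ge0 //.
    apply: le_trans ES _; rewrite -ler_pdivrMr //.
    have := ler_norm l; move: hS; rewrite ler_norml => /andP[_]; lra.
  apply: le_trans (ler_normB _ _) _.
  by rewrite (ger0_norm (Epos N)) normrM (gtr0_norm gN) mulrDl lerD2r.
have Pj j : P ((5 / 6) ^+ j * C0).
  elim: j => [|j IH]; first by rewrite expr0 mul1r.
  by rewrite exprS -mulrA; apply: step => //; rewrite mulr_gt0 // exprn_gt0.
apply/cvgnP => e e0.
have : (5 / 6) ^+ j * C0 @[j --> \oo] --> 0 * C0.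
  apply: cvgM; last exact: cvg_cst.
  by apply: cvg_expr; rewrite ger0_norm; lra.
rewrite mul0r => /cvgnP /(_ _ e0) [j /(_ j (leqnn _))].
rewrite subr0 ger0_norm ?mulr_ge0 ?exprn_ge0 ?(ltW C0_gt0) // => je.
have [n0 hn0] := Pj j.
exists (maxn 2 n0) => n; rewrite geq_max => /andP[n2 /hn0 fn].
have gn := gauge_gt0 n n2.
have -> : E n / g n - l / z = f n / g n.
  by rewrite /f mulrBl mulfK // lt0r_neq0.
rewrite normrM normfV (gtr0_norm gn) ler_pdivrMr //.
by apply: le_trans fn _; rewrite ler_pM2r.
Qed.

End Exponent.

End Asymptotics.

(** * The Basel sum *)

Section Basel.
Variable R : realType.

Lemma sin_le_id (x : R) : 0 <= x -> sin x <= x.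
Proof.
rewrite le_eqVlt => /orP[/eqP <-|x0]; first by rewrite sin0.
have [|c cx] := @MVT R sin cos 0 x x0 (fun y _ => is_derive_sin y).
  by apply: continuous_subspaceT => y; apply: continuous_sin.
by rewrite sin0 !subr0 => ->; rewrite ler_piMl ?cos_le1 // ltW.
Qed.

Lemma id_le_tan (x : R) : 0 <= x < pi / 2 -> x <= tan x.
Proof.
case/andP; rewrite le_eqVlt => /orP[/eqP <-|x0] xpi; first by rewrite tan0.
have cosy y : 0 <= y <= x -> 0 < cos y :> R.
  move=> /andP[y0 yx]; apply: cos_gt0_pihalf.
  by have := pi_gt0 R; lra.
have [||c] := @MVT R tan (fun y => (cos y) ^- 2) 0 x x0.
- move=> y; rewrite in_itv /= => /andP[/ltW y0 /ltW yx].
  by apply: is_derive_tan; rewrite lt0r_neq0 // cosy // y0.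
- apply: continuous_in_subspaceT => y; rewrite inE /= in_itv /= => yx.
  by apply: continuous_tan; rewrite lt0r_neq0 // cosy.
rewrite in_itv /= => /andP[/ltW c0 /ltW cx].
have cc : 0 < cos c by rewrite cosy // c0.
rewrite tan0 !subr0 => ->; rewrite ler_peMl ?(ltW x0) //.
by rewrite invf_ge1 ?exprn_gt0 // exprn_ile1 ?cos_le1 ?ltW.
Qed.

(** This is [sin x <= x <= tan x], since [1 / sin ^ 2 - 1 = 1 / tan ^ 2]. *)
Lemma inv_sqr_between (x : R) : 0 < x < pi / 2 ->
  (sin x) ^- 2 - 1 <= x ^- 2 <= (sin x) ^- 2.
Proof.
move=> /andP[x0 xpi].
have s0 : 0 < sin x by apply: sin_gt0_pihalf; rewrite x0.
have c0 : 0 < cos x by apply: cos_gt0_pihalf; have := pi_gt0 R; lra.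
apply/andP; split; last first.
  by rewrite lef_pV2 ?posrE ?exprn_gt0 // lerXn2r ?nnegrE ?sin_le_id ?ltW.
have xt : x <= tan x by apply: id_le_tan; rewrite ltW.
have t0 : 0 < tan x by rewrite /tan divr_gt0.
have -> : (sin x) ^- 2 - 1 = (tan x) ^- 2.
  rewrite /tan expr_div_n invf_div -[X in _ - X](divff (_ : sin x ^+ 2 != 0)).
    by rewrite -[X in X - _]mul1r -mulrBl cos2sin2.
  by rewrite expf_neq0 // lt0r_neq0.
by rewrite lef_pV2 ?posrE ?exprn_gt0 // lerXn2r ?nnegrE ?(ltW x0) ?(ltW t0).
Qed.

Lemma sum_cos_sin (M : nat) (h : R) : M%:R * h = pi / 2 ->
  \sum_(1 <= k < M) (cos (k%:R * h)) ^- 2 = \sum_(1 <= k < M) (sin (k%:R * h)) ^- 2.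
Proof.
move=> Mh; rewrite big_nat_rev /=; apply: eq_big_nat => k /andP[k0 kM].
rewrite add1n subSS natrB ?(ltnW kM) // mulrBl Mh.
by rewrite cosB cos_pihalf sin_pihalf mul0r mul1r add0r.
Qed.

Let csc2_sum (M : nat) : R := \sum_(1 <= k < M) (sin (k%:R * (pi / 2 / M%:R))) ^- 2.

(** Reflection [k -> 2 * M - k] turns sines into cosines, so twice the left side
    is the sum of [1 / sin ^ 2 x + 1 / cos ^ 2 x = 4 / sin ^ 2 (2 * x)].  The
    angles [2 * x] are symmetric about [pi / 2]: they give the sum for [M]
    twice, and the value 1 at [pi / 2] itself. *)
Lemma csc2_sum_double M : (0 < M)%N -> csc2_sum (2 * M) = 4 * csc2_sum M + 2.
Proof.
move=> M0; have Mr : M%:R != 0 :> R by rewrite pnatr_eq0 -lt0n.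
pose h : R := pi / 2 / (2 * M)%:R.
have h2 : (2 * M)%:R * h = pi / 2.
  by rewrite /h mulrC divfK // natrM mulf_neq0.
have h1 : M%:R * (2 * h) = pi / 2 by rewrite -h2 natrM; ring.
have hE : pi / 2 / M%:R = 2 * h by rewrite /h natrM; field.
suff : 2 * csc2_sum (2 * M) = 4 * (2 * csc2_sum M + 1) by lra.
transitivity (\sum_(1 <= k < 2 * M) 4 * (sin (k%:R * (2 * h))) ^- 2).
  rewrite mulr_natl mulr2n -{1}/csc2_sum /csc2_sum -/h -{1}(sum_cos_sin _ _ h2) -big_split /=.
  apply: eq_big_nat => k /andP[k0 kM].
  have kh : 0 < k%:R * h < pi / 2.
    have hp : 0 < h by rewrite /h !divr_gt0 ?pi_gt0 // ltr0n muln_gt0.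
    by rewrite mulr_gt0 ?ltr0n //= -h2 ltr_pM2r // ltr_nat.
  have s0 : sin (k%:R * h) != 0 by rewrite lt0r_neq0 // sin_gt0_pihalf.
  have c0 : cos (k%:R * h) != 0.
    rewrite lt0r_neq0 // cos_gt0_pihalf //; have := pi_gt0 R; move: kh; lra.
  have -> : k%:R * (2 * h) = (k%:R * h) *+ 2 by rewrite -mulr_natl; ring.
  rewrite sin_mulr2n; move: s0 c0 (cos2Dsin2 (k%:R * h)).
  move: (sin _) (cos _) => s c s0 c0 cs.
  have -> : c ^- 2 + s ^- 2 = (c ^+ 2 + s ^+ 2) / (c ^+ 2 * s ^+ 2).
    by field; rewrite s0 c0.
  by rewrite cs; field; rewrite s0 c0.
rewrite -mulr_sumr; congr (_ * _).
have tail : \sum_(M.+1 <= k < 2 * M) (sin (k%:R * (2 * h))) ^- 2 =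
    \sum_(1 <= k < M) (sin (k%:R * (2 * h))) ^- 2.
  rewrite -[M.+1]add1n big_addn mul2n -addnn addnK -(sum_cos_sin _ _ h1).
  by apply: eq_bigr => k _; rewrite natrD mulrDl h1 sinDpihalf.
rewrite (@big_cat_nat _ _ _ M) //=; last by rewrite mul2n -addnn leq_addr.
rewrite [X in _ + X]big_ltn; last by rewrite mul2n -addnn -{1}[M]addn0 ltn_add2l.
rewrite h1 sin_pihalf expr1n invr1.
rewrite tail /csc2_sum hE; ring.
Qed.

Lemma csc2_sum_pow2 n : csc2_sum (2 ^ n) = 2 / 3 * (4 ^+ n - 1).
Proof.
elim: n => [|n IH]; first by rewrite /csc2_sum big_geq // expr0 subrr mulr0.
by rewrite expnS csc2_sum_double ?expn_gt0 // IH exprS; field.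
Qed.

Lemma sum_inv_sqr_bounds M : (0 < M)%N ->
  csc2_sum M - M%:R <= 4 * M%:R ^+ 2 / pi ^+ 2 * \sum_(1 <= k < M) (k ^ 2)%:R^-1 <= csc2_sum M.
Proof.
move=> M0; have Mr : 0 < M%:R :> R by rewrite ltr0n.
have p0 := pi_gt0 R.
have -> : 4 * M%:R ^+ 2 / pi ^+ 2 * \sum_(1 <= k < M) (k ^ 2)%:R^-1 =
   \sum_(1 <= k < M) (k%:R * (pi / 2 / M%:R)) ^- 2 :> R.
  rewrite mulr_sumr; apply: eq_big_nat => k /andP[k0 _].
  have kn : k%:R != 0 :> R by rewrite pnatr_eq0 -lt0n.
  rewrite natrX; move: (@pi R) p0 => P P0; field; by rewrite kn !lt0r_neq0.
have kb k : (0 < k < M)%N -> 0 < k%:R * ((pi : R) / 2 / M%:R) < (pi : R) / 2.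
  move=> /andP[k0 kM]; have h0 : 0 < pi / 2 :> R by rewrite divr_gt0.
  rewrite mulr_gt0 ?divr_gt0 ?ltr0n //= mulrCA gtr_pMr //.
  by rewrite ltr_pdivrMr // mul1r ltr_nat.
apply/andP; split; last first.
  by apply: ler_sum_nat => k /kb /inv_sqr_between /andP[].
have Mb : \sum_(1 <= k < M) 1 <= M%:R :> R.
  by rewrite sumr_const_nat ler_nat leq_subr.
apply: (@le_trans _ _ (csc2_sum M - \sum_(1 <= k < M) 1)); first lra.
by rewrite /csc2_sum -sumrB; apply: ler_sum_nat => k /kb /inv_sqr_between /andP[].
Qed.

(** Comparing [1 / x ^ 2] with [1 / sin ^ 2 x] at the [M = 2 ^ n] equally spaced
    angles loses at most [M], while the sum of squares is of order [M ^ 2]. *)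
Lemma basel_sum : \sum_(1 <= k < N.+1) (k ^ 2)%:R^-1 @[N --> \oo] --> (pi ^+ 2 / 6 : R).
Proof.
pose Z N : R := \sum_(1 <= k < N) (k ^ 2)%:R^-1.
have p0 : 0 < pi ^+ 2 :> R by rewrite exprn_gt0 ?pi_gt0.
have Zmono m n : (m <= n)%N -> Z m <= Z n.
  move=> mn; rewrite /Z.
  apply: (@nondecreasing_series R (fun k => (k ^ 2)%:R^-1) xpredT 1%N _ m n mn).
  by move=> k _ _; rewrite invr_ge0.
have bounds n : pi ^+ 2 / 6 - pi ^+ 2 * (2 ^ n)%:R^-1 <= Z (2 ^ n)%N <= pi ^+ 2 / 6.
  have M0 : (0 < 2 ^ n)%N by rewrite expn_gt0.
  have Mr : 1 <= (2 ^ n)%:R :> R by rewrite ler1n.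
  have := sum_inv_sqr_bounds _ M0; rewrite csc2_sum_pow2 -/(Z _).
  have -> : 4 ^+ n = (2 ^ n)%:R ^+ 2 :> R.
    by rewrite natrX -exprM mulnC exprM -[in RHS]natrX.
  move: (2 ^ n)%:R Mr (Z _) (pi ^+ 2) p0 => M M1 z P P0.
  have MM : 0 < 4 * M ^+ 2 / P by rewrite divr_gt0 // mulr_gt0 ?exprn_gt0 //; lra.
  have M_neq0 : M != 0 by rewrite lt0r_neq0 //; lra.
  move=> /andP[lo up]; apply/andP; split.
    rewrite -(ler_pM2l MM); apply: le_trans lo.
    have -> : 4 * M ^+ 2 / P * (P / 6 - P / M) = 2 / 3 * M ^+ 2 - 4 * M.
      by field; rewrite M_neq0 lt0r_neq0.
    lra.
  rewrite -(ler_pM2l MM); apply: le_trans up _.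
  have -> : 4 * M ^+ 2 / P * (P / 6) = 2 / 3 * M ^+ 2.
    by field; rewrite lt0r_neq0.
  lra.
apply/cvgnP => e e0.
have [n hn] : exists n, pi ^+ 2 / e <= (2 ^ n)%:R :> R.
  exists (Num.bound (pi ^+ 2 / e)); apply: ltW.
  apply: lt_trans (archi_boundP _) _; first by rewrite divr_ge0 // ltW.
  by rewrite ltr_nat ltn_expl.
exists (2 ^ n)%N => N nN; rewrite -/(Z N.+1).
have /andP[lo _] := bounds n; have /andP[_ up] := bounds N.
have h1 : Z (2 ^ n)%N <= Z N.+1 by apply: Zmono; rewrite (leq_trans nN).
have h2 : Z N.+1 <= Z (2 ^ N)%N by apply: Zmono; rewrite ltn_expl.
have h3 : pi ^+ 2 * (2 ^ n)%:R^-1 <= e.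
  by rewrite ler_pdivrMr ?ltr0n ?expn_gt0 // mulrC -ler_pdivrMr.
rewrite ler_norml; apply/andP; split; lra.
Qed.

End Basel.

(** * The two counting functions *)

Lemma divsum_asymptotic (R : realType) k :
  (divsum k N)%:R / (N%:R * ln (N%:R : R) ^+ k) @[N --> \oo] --> (k`!%:R^-1 : R).
Proof.
elim: k => [|k IH].
  rewrite fact0 invr1; apply: (@cvg_trans _ ((1 : R) @[N --> \oo])); last exact: cvg_cst.
  apply: near_eq_cvg; exists 1%N => // N /= N0.
  by rewrite expr0 mulr1 divff // pnatr_eq0 -lt0n.
rewrite factS natrM invfM mulrC.
have : (\sum_(1 <= m < N.+1) (divsum k (N %/ m))%:R) /
    (N%:R * ln (N%:R : R) ^+ k.+1) @[N --> \oo] --> (k`!%:R^-1 / k.+1%:R : R).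
  apply: (@sum_floor_asymptotic R (fun n => (divsum k n)%:R)) IH.
    by rewrite divsum0.
  by move=> m n mn; rewrite ler_nat; apply: leq_divsum.
by under eq_fun do rewrite -natr_sum.
Qed.

(** By [divsum_div] the [r]-th term is at most [1 / r ^ 2] times
    [divsum 1 N], which is of order [N * ln N]. *)
Lemma common_divisors_negligible (R : realType) :
  (common_divisors_sum N)%:R / (N%:R * ln (N%:R : R) ^+ 2) @[N --> \oo] --> (0 : R).
Proof.
apply: (@squeeze_cvgr _ _ _ _ (fun=> 0) (fun N => pi ^+ 2 / 6 *
   ((divsum 1 N)%:R / (N%:R * ln (N%:R : R) ^+ 1) * (ln N%:R)^-1))); last 2 first.
- exact: cvg_cst.
- have : pi ^+ 2 / 6 * ((divsum 1 N)%:R / (N%:R * ln (N%:R : R) ^+ 1) * (ln N%:R)^-1)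
    @[N --> \oo] --> (pi ^+ 2 / 6 * ((1`!)%:R^-1 * 0) : R).
    apply: cvgM; first exact: cvg_cst.
    by apply: cvgM; [exact: divsum_asymptotic | exact: ln_invr0].
  by rewrite !mulr0.
exists 2%N => // N /= N2.
have N0 : 0 < N%:R :> R by rewrite ltr0n ltnW.
have L0 := ln_nat_gt0 R N N2.
have d0 : 0 < N%:R * ln (N%:R : R) ^+ 2 by rewrite mulr_gt0 ?exprn_gt0.
apply/andP; split; first by rewrite divr_ge0 // ltW.
have -> : (divsum 1 N)%:R / (N%:R * ln N%:R ^+ 1) * (ln N%:R)^-1 =
  (divsum 1 N)%:R / (N%:R * ln N%:R ^+ 2) :> R.
  by field; rewrite !lt0r_neq0.
rewrite [leRHS]mulrA; apply: ler_wpM2r; first by rewrite invr_ge0 ltW.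
apply: (@le_trans _ _ ((\sum_(1 <= r < N.+1) (r ^ 2)%:R^-1) * (divsum 1 N)%:R)).
  rewrite /common_divisors_sum natr_sum mulr_suml; apply: ler_sum_nat => r /andP[r0 _].
  rewrite ler_pdivlMl ?ltr0n ?expn_gt0 ?r0 // -natrM ler_nat.
  by rewrite divsum_div // expn_gt0 r0.
by rewrite ler_wpM2r //; apply: sum_inv_sqr_le_lim; apply: basel_sum.
Qed.

Theorem theorem1 (R : realType) :
  ((A N)%:R / (B N)%:R) / (pi ^+ 2 / ln (N%:R : R)) @[N --> \oo] --> (1 : R).
Proof.
have P0 : pi ^+ 2 != 0 :> R by rewrite expf_neq0 // lt0r_neq0 ?pi_gt0.
have Alim : (A N)%:R / (N%:R * ln (N%:R : R) ^+ 2) @[N --> \oo] --> (1 : R).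
  have : 2 * ((divsum 2 N)%:R / (N%:R * ln (N%:R : R) ^+ 2)) -
      (common_divisors_sum N)%:R / (N%:R * ln (N%:R : R) ^+ 2)
      @[N --> \oo] --> (2 * (2`!)%:R^-1 - 0 : R).
    apply: cvgB; last exact: common_divisors_negligible.
    by apply: cvgM; [exact: cvg_cst | exact: divsum_asymptotic].
  rewrite subr0 divff ?pnatr_eq0 //; apply: cvg_trans; apply: near_eq_cvg.
  apply: nearW => N /=; rewrite mulrA -mulrBl; congr (_ / _).
  by rewrite mulr_natl -mulr_natl -natrM mul2n -A_add_common_divisors natrD addrK.
have Blim : (B N)%:R / (N%:R * ln (N%:R : R) ^+ 3) @[N --> \oo] --> ((pi ^+ 2)^-1 : R).
  have -> : (pi ^+ 2)^-1 = (3`!)%:R^-1 / (pi ^+ 2 / 6) :> R.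
    by rewrite invf_div mulrA mulVf ?mul1r ?pnatr_eq0.
  apply: (@square_inversion R 2 _ (@basel_sum R) (fun N => (B N)%:R)) => //.
    by rewrite B_sum_floor_lcm big_geq.
  have := @divsum_asymptotic R 3; under [in X in X -> _]eq_fun do rewrite -sum_B_square natr_sum.
  by [].
have lim : (A N)%:R / (N%:R * ln (N%:R : R) ^+ 2) *
   ((B N)%:R / (N%:R * ln (N%:R : R) ^+ 3))^-1 * (pi ^+ 2)^-1
   @[N --> \oo] --> (1 * (pi ^+ 2)^-1^-1 * (pi ^+ 2)^-1 : R).
  apply: cvgM; last exact: cvg_cst.
  by apply: cvgM => //; apply: cvgV => //; rewrite invr_eq0.
move: lim; rewrite invrK mul1r divff //; apply: cvg_trans; apply: near_eq_cvg.
exists 2%N => // N /= N2.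
have [->|B0] := eqVneq ((B N)%:R : R) 0; first by rewrite !(mul0r, invr0, mulr0).
have N0 : N%:R != 0 :> R by rewrite pnatr_eq0 -lt0n ltnW.
have := lt0r_neq0 (ln_nat_gt0 R N N2); move: (pi ^+ 2) P0 => P P0 L0.
by field; rewrite B0 N0 P0 L0.
Qed.
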